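(* Let $n,N\ge1$ and $d\ge2$ be integers with $N\le\binom{\lfloor\sqrt{nd/2}\rfloor}{d}$, and let $z\ge1$ be real. Let $\mathbf A$ be either $\mathbf A_{n,d}$ (uniform case), in which case assume $d\le n/4$, or $\bigcup_{k=1}^d\mathbf A_{n,k}$ (non-uniform case), in which case assume $d\le n/16$. Let $$\varphi_{\min,\delta}=\min\left\{\frac{54N\log(4Nn^z)}{\binom nd-2^{d+1}N},1\right\}\ \text{(uniform case)},\qquad \varphi_{\min,\delta}=\min\left\{\frac{54N\log(4Nn^z)}{\sum_{k=1}^d\binom nk-2^{2d+1}N},1\right\}\ \text{(non-uniform case)}.$$ Let $\mathbf X\subseteq\mathbf A$ be random, containing each $\mathbf e\in\mathbf A$ independently with the same probability $\varphi\in[\varphi_{\min,\delta},1]$. Then, with probability at least $1-\frac1{n^z}$, the IC-design partition $(\mathbf\Phi_1,\dots,\mathbf\Phi_N)$ of $\mathbf X$ has load balance factor $$\delta_{\mathbf X}=\frac{\max_{b\in[N]}|\mathbf\Phi_b|}{\lceil|\mathbf X|/N\rceil}\le5.$$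
   Context: $[n]=\{1,\dots,n\}$, and $\mathbf A_{n,k}$ is the set of all $k$-element subsets of $[n]$. $\log$ is the natural logarithm. The event $\delta_{\mathbf X}\le 5$ is understood to include $\mathbf X\neq\emptyset$, so that $\delta_{\mathbf X}$ is defined. **IC (interweaved-cliques) design** for $(n,d,N)$. Let $f=\max\{r\ge d:\binom rd\le N\}$ and $N'=\binom fd$. Let $s=n/f$ if $f\mid n$ and $s=\lfloor n/(f+d)\rfloor+1$ otherwise (under the assumptions here, $fs\le n$). Let $\mathcal F_i=\{(i-1)s+1,\dots,is\}$ for $i\in[f]$; the vertices $fs+1,\dots,n$ lie in no family. For $\mathbf e\subseteq[n]$ let $\mathcal B(\mathbf e)=\{j\in[f]:\mathbf e\cap\mathcal F_j\ne\emptyset\}$. Step A. For each $k$ (only $k=d$ in the uniform case; $k=1,\dots,d$ in the non-uniform case), $\mathbf A_{n,k}$ is split into groups $\widetilde{\mathbf\Phi}^k_\sigma$ indexed by the $d$-subsets $\sigma$ of $[f]$, as follows. For each $\mathcal I\subseteq[f]$ with $|\mathcal I|\le k$, list $\mathbf Q^k_{\mathcal I}=\{\mathbf e\in\mathbf A_{n,k}:\mathcal B(\mathbf e)=\mathcal I\}$ in lexicographic order. List the $d$-subsets $\sigma\supseteq\mathcal I$ of $[f]$ in lexicographic order as $\sigma_1,\dots,\sigma_m$, with $m=\binom{f-|\mathcal I|}{d-|\mathcal I|}$. Write $|\mathbf Q^k_{\mathcal I}|=qm+r$ with $0\le r<m$. Cut the list of $\mathbf Q^k_{\mathcal I}$ into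 $m$ consecutive blocks, the first $r$ of size $q+1$ and the others of size $q$, and assign the $j$-th block to $\sigma_j$. $\widetilde{\mathbf\Phi}^k_\sigma$ is the union of all blocks assigned to $\sigma$ over all such $\mathcal I$. Step B. Order the $N'$ indices $\sigma$ lexicographically and rename the groups $\widetilde{\mathbf\Phi}^k_1,\dots,\widetilde{\mathbf\Phi}^k_{N'}$. Let $r=N\bmod N'$, and let $s_b=\lceil N/N'\rceil$ for $b\le r$ and $s_b=\lfloor N/N'\rfloor$ for $r<b\le N'$. Split the old group $\widetilde{\mathbf\Phi}^k_b$ into $s_b$ sub-parts numbered $0,\dots,s_b-1$ by going through it in lexicographic order in a round-robin manner (so sub-part sizes differ by at most $1$). Sub-part $b'$ of old group $b$ becomes the new group with index $b+b'N'$. This gives $N$ groups $\widetilde{\mathbf\Phi}^k_1,\dots,\widetilde{\mathbf\Phi}^k_N$ for each $k$. Set $\widetilde{\mathbf\Phi}_b=\widetilde{\mathbf\Phi}^d_b$ in the uniform case and $\widetilde{\mathbf\Phi}_b=\bigcup_{k=1}^d\widetilde{\mathbf\Phi}^k_b$ in the non-uniform case; these partition $\mathbf A$. Step C. For $\mathbf X\subseteq\mathbf A$, the IC partition of $\mathbf X$ is $\mathbf\Phi_b=\widetilde{\mathbf\Phi}_b\cap\mathbf X$, $b\in[N]$. *)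

(* Defs.v *)
From HB Require Import structures.
From mathcomp Require Import all_boot all_order all_algebra.
From mathcomp Require Import all_classical all_reals all_analysis.
Set Implicit Arguments.
Unset Strict Implicit.
Unset Printing Implicit Defensive.
Import Order.TTheory GRing.Theory Num.Theory.

(* Indices are 0-based throughout: the vertex set [n] is 'I_n, and families and
   groups are numbered from 0. *)

Definition ksets (n k : nat) : {set {set 'I_n}} :=
  [set e : {set 'I_n} | #|e| == k].

(* [enum] lists a set of ordinals in increasing order. *)
Definition lexle (n : nat) (e1 e2 : {set 'I_n}) : bool :=
  ((enum e1 : seqlexi 'I_n) <= (enum e2 : seqlexi 'I_n))%O.

Definition lexlist (n : nat) (S : {set {set 'I_n}}) : seq {set 'I_n} :=
  sort (@lexle n) (enum S).

(* Only meaningful for 0 < b. *)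
Definition ceil_div (a b : nat) : nat := (a + b.-1) %/ b.

Definition cut_blocks (T : Type) (m : nat) (s : seq T) : seq (seq T) :=
  let q := size s %/ m in
  let r := size s %% m in
  reshape (nseq r q.+1 ++ nseq (m - r) q) s.

(* The bound r < N + d does not restrict the maximum: see [ic_fP]. *)
Definition ic_f (d N : nat) : nat :=
  \max_(r < N + d | (d <= r) && ('C(r, d) <= N)) r.

Definition ic_N' (d N : nat) : nat := 'C(ic_f d N, d).

Definition ic_s (n d N : nat) : nat :=
  let f := ic_f d N in
  if f %| n then n %/ f else (n %/ (f + d)).+1.

Definition ic_family (n d N : nat) (i : 'I_(ic_f d N)) : {set 'I_n} :=
  [set v : 'I_n | i * ic_s n d N <= v < i.+1 * ic_s n d N].

Definition ic_met (n d N : nat) (e : {set 'I_n}) : {set 'I_(ic_f d N)} :=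
  [set j | e :&: ic_family n j != finset.set0].

Definition ic_Q (n d N k : nat) (I : {set 'I_(ic_f d N)}) : {set {set 'I_n}} :=
  [set e in ksets n k | ic_met d N e == I].

Definition ic_supersets (d N : nat) (I : {set 'I_(ic_f d N)}) :
    seq {set 'I_(ic_f d N)} :=
  lexlist [set sigma in ksets (ic_f d N) d | I \subset sigma].

Definition ic_block (n d N k : nat) (I sigma : {set 'I_(ic_f d N)}) :
    {set {set 'I_n}} :=
  let sigmas := ic_supersets I in
  [set:: nth [::] (cut_blocks (size sigmas) (lexlist (ic_Q n k I)))
                  (index sigma sigmas)].

Definition ic_old_group (n d N k : nat) (sigma : {set 'I_(ic_f d N)}) :
    {set {set 'I_n}} :=
  \bigcup_(I : {set 'I_(ic_f d N)} | (#|I| <= k) && (I \subset sigma))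
    ic_block n k I sigma.

Definition ic_old_group_idx (n d N k b : nat) : {set {set 'I_n}} :=
  ic_old_group n k (nth finset.set0 (lexlist (ksets (ic_f d N) d)) b).

Definition ic_parts (d N b : nat) : nat :=
  if b < N %% ic_N' d N then ceil_div N (ic_N' d N) else N %/ ic_N' d N.

Definition round_robin (n : nat) (S : {set {set 'I_n}}) (m j : nat) :
    {set {set 'I_n}} :=
  [set e in S | index e (lexlist S) %% m == j].

(* With 0-based numbering, part b' of old group b gets the index
   c = b + b' * N', that is, b = c %% N' and b' = c %/ N'. *)
Definition ic_group_k (n d N k c : nat) : {set {set 'I_n}} :=
  let b := c %% ic_N' d N in
  round_robin (ic_old_group_idx n d N k b) (ic_parts d N b) (c %/ ic_N' d N).

Variant hypergraph_case := UniformCase | NonUniformCase.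

Definition edges (u : hypergraph_case) (n d : nat) : {set {set 'I_n}} :=
  match u with
  | UniformCase => ksets n d
  | NonUniformCase => \bigcup_(1 <= k < d.+1) ksets n k
  end.

Definition ic_group (u : hypergraph_case) (n d N b : nat) : {set {set 'I_n}} :=
  match u with
  | UniformCase => ic_group_k n d N d b
  | NonUniformCase => \bigcup_(1 <= k < d.+1) ic_group_k n d N k b
  end.

Definition ic_partition (u : hypergraph_case) (n d N : nat)
    (X : {set {set 'I_n}}) (b : 'I_N) : {set {set 'I_n}} :=
  ic_group u n d N b :&: X.
Arguments ic_partition u {n} d N X b.

Lemma ic_fP (d N : nat) : 0 < d -> 0 < N ->
  [/\ d <= ic_f d N, 'C(ic_f d N, d) <= N
    & forall r, d <= r -> 'C(r, d) <= N -> r <= ic_f d N].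
Proof.
move=> d0 N0.
have bnd r : d <= r -> 'C(r, d) <= N -> r < N + d.
  move=> dr rN; rewrite -(subnK dr) ltn_add2r.
  apply: leq_trans rN; rewrite -{2}(subnK dr).
  elim: (r - d) => [|m IH]; first by rewrite add0n binn.
  case: d d0 {dr} IH => // d _ IH.
  rewrite addSn binS -[m.+2]addn1; apply: leq_add => //.
  by rewrite bin_gt0 addnS ltnW // ltnS leq_addl.
have max r : d <= r -> 'C(r, d) <= N -> r <= ic_f d N.
  move=> dr rN.
  by apply: (@leq_bigmax_cond _ _ _ (Ordinal (bnd r dr rN))); rewrite dr rN.
split=> //; first by apply: max; rewrite ?binn.
rewrite /ic_f; elim/big_ind: _ => [|x y Hx Hy|i /andP[] //].
  by rewrite bin0n; case: d d0 {bnd max}.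
by rewrite /maxn; case: ifP.
Qed.

Local Open Scope ring_scope.

Definition load_balance (R : realType) (n N : nat)
    (Phi : 'I_N -> {set {set 'I_n}}) (X : {set {set 'I_n}}) : R :=
  (\max_(b < N) #|Phi b|)%N%:R / (ceil_div #|X| N)%:R.

Definition phi_min (R : realType) (u : hypergraph_case) (n d N : nat) (z : R) : R :=
  let denom : R := match u with
    | UniformCase => 'C(n, d)%:R - 2 ^+ d.+1 * N%:R
    | NonUniformCase => (\sum_(1 <= k < d.+1) 'C(n, k))%N%:R - 2 ^+ (2 * d).+1%N * N%:R
    end in
  Num.min (54 * N%:R * ln (4 * N%:R * n%:R `^ z) / denom) 1.

Local Open Scope classical_set_scope.

Definition mutually_independent (dT : measure_display) (T : measurableType dT)
    (R : realType) (P : probability T R) (I : finType) (A : {set I})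
    (E : I -> set T) : Prop :=
  (forall i, i \in A -> measurable (E i)) /\
  forall J : {set I}, J \subset A ->
    P (\bigcap_(i in [set` J]) E i) = (\prod_(i in J) P (E i))%E.

Definition random_subset (dT : measure_display) (T : measurableType dT)
    (R : realType) (P : probability T R) (I : finType) (A : {set I}) (phi : R)
    (X : T -> {set I}) : Prop :=
  [/\ forall w, X w \subset A,
      mutually_independent P A (fun i => [set w | i \in X w])
    & forall i, i \in A -> P [set w | i \in X w] = phi%:E].

(* Main.v *)
(* Permuting the equal-size families shows that |Q_I| depends only on |I|, so the
   ideal (fractional) size of an old group is the same for all sigma and hence at
   most C(n, k) / N'.  Rounding costs 2^d per k, so every group has at most
   2 |A| / N + D + 1 elements with D = 2^(d+1), resp. 2^(2d+1).  The bounds on N and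
   d give D N < |A|, so with m = phi |A| / N every group has expected intersection at
   most 3 m + 1 with X.  If phi_min < 1 then m >= 54 log(4 N n^z), and exponential
   moments give |X| > 3/4 N m and |Phi_b| < 15/4 m for all b, up to a total
   probability (N + 1) / (4 N n^z).  If phi = 1 then X = A almost surely.  The
   exponential moment of |B :&: X| is obtained from the probabilities of the events
   J \subset X by expanding (1 + a)^|B :&: X| as a sum of a^|J| over subsets J. *)
Require Import Defs.
From HB Require Import structures.
From mathcomp Require Import all_boot all_order all_algebra.
From mathcomp Require Import perm.
From mathcomp Require Import all_classical all_reals all_analysis.
From mathcomp Require Import zify ring lra.
Set Implicit Arguments.
Unset Strict Implicit.
Unset Printing Implicit Defensive.
Import Order.TTheory GRing.Theory Num.Theory.

(** * Sizes of the blocks and of the round-robin parts *)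

Lemma size_nth_cut_blocks (T : Type) (m i : nat) (s : seq T) :
  size (nth [::] (cut_blocks m s) i) <= (size s %/ m).+1.
Proof.
rewrite /cut_blocks nth_reshape size_take_min (leq_trans (geq_minl _ _))//.
by rewrite nth_cat !nth_nseq; do ![case: ifP] => // _ _; rewrite leqnSn.
Qed.

Lemma size_lexlist (n : nat) (S : {set {set 'I_n}}) : size (lexlist S) = #|S|.
Proof. by rewrite size_sort -cardE. Qed.

Lemma mem_lexlist (n : nat) (S : {set {set 'I_n}}) : lexlist S =i S.
Proof. by move=> e; rewrite mem_sort mem_enum. Qed.

Lemma leq_card_block (n d N k : nat) (I sigma : {set 'I_(ic_f d N)}) :
  #|ic_block n k I sigma| <=
    (#|ic_Q n k I| %/ #|[set s in ksets (ic_f d N) d | I \subset s]|).+1.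
Proof.
rewrite /ic_block cardsE (leq_trans (card_size _))//.
by rewrite (leq_trans (size_nth_cut_blocks _ _ _))// !size_lexlist.
Qed.

(** Indices in one part agree modulo [m], so an element is determined by the quotient of its index
    by [m], and this quotient is at most [#|S| %/ m]. *)
Lemma leq_card_round_robin (n : nat) (S : {set {set 'I_n}}) (m j : nat) :
  0 < m -> #|round_robin S m j| <= (#|S| %/ m).+1.
Proof.
move=> m0; pose g e : 'I_(#|S| %/ m).+1 := inord (index e (lexlist S) %/ m).
have lt e : e \in S -> index e (lexlist S) < #|S|.
  by move=> eS; rewrite -size_lexlist index_mem mem_lexlist.
have inj : {in round_robin S m j &, injective g}.
  move=> e1 e2; rewrite !inE => /andP[S1 /eqP j1] /andP[S2 /eqP j2] /(congr1 val).
  rewrite /= !inordK ?ltnS ?leq_div2r ?(ltnW (lt _ _))// => eq.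
  have : index e1 (lexlist S) = index e2 (lexlist S).
    by rewrite (divn_eq (index e1 _) m) (divn_eq (index e2 _) m) eq j1 j2.
  by move=> /index_inj; apply; rewrite ?mem_lexlist.
by rewrite -(card_in_imset inj) (leq_trans (max_card _))// card_ord.
Qed.

(** * Permutations of the families, acting on vertices and edges *)

Section FamilyPermutation.
Variables n d N : nat.
Local Notation f := (ic_f d N).
Local Notation s := (ic_s n d N).
Hypothesis fs_le_n : f * s <= n.

Lemma mem_family (v : 'I_n) (j : 'I_f) :
  (v \in ic_family n j) = (v < f * s) && (v %/ s == j).
Proof.
rewrite inE; case: (posnP s) => [->|s0]; first by rewrite !muln0 ltn0 andbF.
rewrite -leq_divRL // -ltn_divLR // ltnS.
rewrite -(ltn_divLR _ _ s0).
by apply/andP/andP => [[h1 h2]|[h1 /eqP->]]; [have := ltn_ord j|]; lia.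
Qed.

(* Moves the family i to the family p i by translation and fixes the vertices lying
   in no family. *)
Definition permute_nat (p : {perm 'I_f}) (v : nat) : nat :=
  if insub (v %/ s) is Some j then (p j : 'I_f) * s + v %% s else v.

Lemma permute_nat_lt (p : {perm 'I_f}) (v : 'I_n) : permute_nat p v < n.
Proof.
rewrite /permute_nat; case: insubP => // j lt _.
(* For [s = 0] the remainder [v %% 0] is [v], so the map is the identity. *)
case: (posnP s) => [->|s0]; first by rewrite muln0 modn0 ltn_ord.
by apply: leq_trans fs_le_n; have := ltn_ord (p j); have := ltn_pmod v s0; nia.
Qed.

Definition permute (p : {perm 'I_f}) (v : 'I_n) : 'I_n :=
  Ordinal (permute_nat_lt p v).

Lemma permuteK (p : {perm 'I_f}) : cancel (permute p) (permute p^-1%g).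
Proof.
move=> v; apply: val_inj; rewrite /= /permute_nat.
case: (insubP _ (v %/ s)) => [j lt vj|nlt]; last by rewrite insubN.
case: (posnP s) => [s0|s0].
  by case: insubP => [i _ _|_]; rewrite s0 !muln0 !modn0.
rewrite divnMDl // divn_small ?ltn_mod // addn0 valK permK.
by rewrite modnMDl modn_mod vj -divn_eq.
Qed.

Lemma mem_family_permute (p : {perm 'I_f}) (v : 'I_n) (j : 'I_f) :
  (permute p v \in ic_family n (p j)) = (v \in ic_family n j).
Proof.
rewrite !mem_family; case: (posnP s) => [->|s0]; first by rewrite muln0 !ltn0.
rewrite /= /permute_nat; case: insubP => [i lt vi|].
  rewrite divnMDl // (divn_small (ltn_pmod _ s0)) addn0 (inj_eq val_inj).
  rewrite (inj_eq perm_inj) -vi -(inj_eq val_inj) -!ltn_divLR //.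
  rewrite divnMDl // (divn_small (ltn_pmod _ s0)) addn0 ltn_ord.
  by rewrite lt.
by rewrite -ltn_divLR // => /negPf ->.
Qed.

Lemma ic_met_permute (p : {perm 'I_f}) (e : {set 'I_n}) :
  ic_met d N (permute p @: e) = p @: ic_met d N e.
Proof.
apply/setP => j; rewrite -[j](permKV p) (mem_imset _ _ perm_inj).
set i := (p^-1)%g j; rewrite !inE; apply/finset.set0Pn/set0Pn => -[v /setIP[ve vj]].
  case/imsetP: ve vj => w we -> ; rewrite mem_family_permute => wi.
  by exists w; apply/setIP.
by exists (permute p v); apply/setIP; rewrite mem_family_permute imset_f.
Qed.

(** The vertex permutation induced by [p] is injective and sends [ic_Q n k I] into
    [ic_Q n k (p @: I)]; the inverse permutation gives the other inequality. *)
Lemma card_ic_Q_perm (k : nat) (p : {perm 'I_f}) (I : {set 'I_f}) :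
  #|ic_Q n k (p @: I)| = #|ic_Q n k I|.
Proof.
have le (q : {perm 'I_f}) J : #|ic_Q n k J| <= #|ic_Q n k (q @: J)|.
  have inj := can_inj (permuteK q).
  rewrite -[X in X <= _](card_imset _ (imset_inj inj)).
  apply: subset_leq_card; apply/fintype.subsetP.
  move=> _ /imsetP[e eQ ->]; move: eQ; rewrite !inE card_imset //.
  by move=> /andP[-> /eqP <-]; rewrite ic_met_permute eqxx.
apply/eqP; rewrite eqn_leq le andbT.
apply: leq_trans (le (p^-1)%g _) _; rewrite -imset_comp.
by rewrite (eq_imset (g := id)) ?imset_id // => x; rewrite /= permK.
Qed.

End FamilyPermutation.

(** * Symmetric functions of finite sets *)

(** Induction on [#|A :\: B|]: swapping some [x] in [A :\: B] with some [y] in [B :\: A] removes [x]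
    from the difference and adds nothing to it. *)
Lemma tperm_invariant_ksets (T : finType) (U : Type) (F : {set T} -> U) :
  (forall x y (A : {set T}), F (tperm x y @: A) = F A) ->
  forall A B : {set T}, #|A| = #|B| -> F A = F B.
Proof.
move=> Finv A B; move: {2}#|A :\: B|.+1 (ltnSn #|A :\: B|) => m.
elim: m A => // m IH A; rewrite ltnS => Am AB.
case: (finset.set_0Vmem (A :\: B)) => [AB0|[x xAB]].
  congr F; apply/eqP; rewrite eqEcard AB leqnn andbT.
  by rewrite -finset.setD_eq0 AB0.
have [y yBA] : exists y, y \in B :\: A.
  apply/finset.set0Pn; rewrite -card_gt0 cardsD finset.setIC -AB -cardsD card_gt0.
  by apply/finset.set0Pn; exists x.
have [/finset.setDP[xA xB] /finset.setDP[yB yA]] := (xAB, yBA).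
rewrite -(Finv x y); apply: IH; last by rewrite card_imset //; exact: perm_inj.
apply: leq_trans Am; rewrite [X in _ < X](cardsD1 x) xAB add1n ltnS.
apply: subset_leq_card; apply/fintype.subsetP => z; rewrite !inE => /andP[zB /imsetP[w wA zE]].
move: zB; rewrite {z}zE; case: tpermP => [wx|wy|/eqP wx wy]; first by rewrite yB.
  by move: wA; rewrite wy (negPf yA).
by rewrite wx wA => ->.
Qed.

Lemma card_ksets (n k : nat) : #|ksets n k| = 'C(n, k).
Proof. by rewrite card_draws card_ord. Qed.

Lemma eq_card_supersets (m d : nat) (p : {perm 'I_m}) (I : {set 'I_m}) :
  #|[set s in ksets m d | p @: I \subset s]| =
  #|[set s in ksets m d | I \subset s]|.
Proof.
have inj := imset_inj (@perm_inj _ p).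
rewrite -[RHS](card_imset _ inj); apply: eq_card => s.
have [t ->] : exists t : {set 'I_m}, s = p @: t.
  exists ((p^-1)%g @: s); rewrite -imset_comp (eq_imset (g := id)) ?imset_id //.
  by move=> x; rewrite /= permKV.
rewrite (mem_imset _ _ inj) !inE (card_imset _ perm_inj).
congr (_ && _); apply/idP/idP => [/fintype.subsetP h|]; last exact: imsetS.
apply/fintype.subsetP => x xI.
by rewrite -(mem_imset _ _ (@perm_inj _ p)) h // imset_f.
Qed.

Lemma natr_divn_le (R : numFieldType) (a b : nat) :
  ((a %/ b)%N%:R <= a%:R / b%:R :> R)%R.
Proof.
case: b => [|b]; first by rewrite divn0 invr0 mulr0.
by rewrite ler_pdivlMr ?ltr0n // -natrM ler_nat leq_trunc_div.
Qed.

(** * Sizes of the old groups *)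

Section OldGroups.
Variables (R : realType) (n d N : nat).
Local Notation f := (ic_f d N).
Hypothesis fs_le_n : f * ic_s n d N <= n.
Local Open Scope ring_scope.

(* The size that the old group would have if all cuts were exact. *)
Definition ideal_size (k : nat) (sigma : {set 'I_f}) : R :=
  \sum_(I : {set 'I_f} | (#|I| <= k)%N && (I \subset sigma))
    #|ic_Q n k I|%:R / #|[set s in ksets f d | I \subset s]|%:R.

Lemma ideal_size_eq (k : nat) (sigma tau : {set 'I_f}) :
  #|sigma| = #|tau| -> ideal_size k sigma = ideal_size k tau.
Proof.
apply: tperm_invariant_ksets => x y {}sigma; set p := tperm x y.
have inj := @perm_inj _ p.
rewrite /ideal_size (reindex_inj (imset_inj inj)) /=; apply: eq_big => I.
  rewrite card_imset //; congr (_ && _).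
  apply/idP/idP => [/fintype.subsetP h|]; last exact: imsetS.
  by apply/fintype.subsetP => z zI; rewrite -(mem_imset _ _ inj) h // imset_f.
by rewrite card_ic_Q_perm // eq_card_supersets.
Qed.

Lemma sum_card_ic_Q (k : nat) :
  (\sum_(I : {set 'I_f}) #|ic_Q n k I|)%N = 'C(n, k).
Proof.
rewrite -card_ksets -[RHS]sum1_card [RHS](partition_big (ic_met d N) predT) //=.
by apply: eq_bigr => I _; rewrite -sum1_card; apply: eq_bigl => e; rewrite inE.
Qed.

(** Double counting: after exchanging the sums, each [I] distributes [#|ic_Q n k I|] evenly over its
    [d]-element supersets. Only an inequality is claimed, since sets [I] with more than [k] elements
    or without such a superset contribute 0. *)
Lemma sum_ideal_size (k : nat) :
  \sum_(sigma in ksets f d) ideal_size k sigma <= 'C(n, k)%:R.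
Proof.
rewrite /ideal_size.
rewrite (exchange_big_dep xpredT) //= -sum_card_ic_Q natr_sum.
apply: ler_sum => I _.
have [kI|] := leqP #|I| k; last first.
  by rewrite big_pred0 ?ler0n // => s; rewrite andbF.
rewrite sumr_const /=.
have -> : #|(fun s : {set 'I_f} => (s \in ksets f d) && (true && (I \subset s)))|
    = #|[set s in ksets f d | I \subset s]|.
  by apply: eq_card => s; rewrite [LHS]unfold_in !inE.
case: (posnP #|[set s in ksets f d | I \subset s]|) => [->|h].
  by rewrite mulr0n ler0n.
by rewrite -[X in X <= _]mulr_natr divfK // pnatr_eq0 -lt0n.
Qed.

(** By symmetry all [N'] ideal sizes are equal, so each is the average. *)
Lemma ideal_size_le (k : nat) (sigma : {set 'I_f}) : sigma \in ksets f d ->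
  ideal_size k sigma <= 'C(n, k)%:R / (ic_N' d N)%:R.
Proof.
move=> sd; have N'0 : (0 < ic_N' d N)%N.
  by rewrite /ic_N' -card_ksets card_gt0; apply/finset.set0Pn; exists sigma.
rewrite ler_pdivlMr ?ltr0n // (le_trans _ (sum_ideal_size k)) //.
rewrite (eq_bigr (fun=> ideal_size k sigma)); last first.
  move=> tau; move: sd; rewrite !inE => /eqP sd /eqP td.
  by apply: ideal_size_eq; rewrite sd td.
by rewrite sumr_const card_ksets mulr_natr.
Qed.

(** Each cut exceeds its ideal size by at most 1, and at most [2 ^ d] sets [I] lie inside
    [sigma]. *)
Lemma card_old_group_le (k : nat) (sigma : {set 'I_f}) : sigma \in ksets f d ->
  #|ic_old_group n k sigma|%:R <= 'C(n, k)%:R / (ic_N' d N)%:R + 2 ^+ d :> R.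
Proof.
move=> sd; apply: le_trans (_ : ideal_size k sigma + 2 ^+ d <= _); last first.
  by rewrite lerD2r ideal_size_le.
apply: (@le_trans _ _ (\sum_(I : {set 'I_f} | (#|I| <= k)%N && (I \subset sigma))
   (#|ic_block n k I sigma|)%:R)).
  rewrite -natr_sum ler_nat /ic_old_group.
  elim/big_rec2: _ => [|I m S _ h]; first by rewrite cards0.
  by rewrite (leq_trans (leq_card_setU _ _)) // leq_add2l.
apply: (@le_trans _ _ (\sum_(I : {set 'I_f} | (#|I| <= k)%N && (I \subset sigma))
   (#|ic_Q n k I|%:R / #|[set s in ksets f d | I \subset s]|%:R + 1))).
  apply: ler_sum => I _.
  have := leq_card_block n k I sigma; rewrite -(ler_nat R) => h; apply: (le_trans h).
  by rewrite -natr1 lerD2r natr_divn_le.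
rewrite big_split /= lerD2l sumr_const -natrX ler_nat.
have -> : (2 ^ d)%N = #|powerset sigma|.
  by rewrite card_powerset; move: sd; rewrite inE => /eqP ->.
apply: subset_leq_card; apply/fintype.subsetP => I; rewrite inE.
by rewrite unfold_in => /andP[].
Qed.

End OldGroups.

(** * Sizes of the groups after the round-robin split *)

Section NewGroups.
Variables (R : realType) (n d N : nat).
Local Notation f := (ic_f d N).
Hypotheses (d_gt0 : 0 < d) (N_gt0 : 0 < N) (fs_le_n : f * ic_s n d N <= n).

Lemma ic_N'_gt0 : 0 < ic_N' d N.
Proof. by have [df _ _] := ic_fP d_gt0 N_gt0; rewrite bin_gt0. Qed.

Lemma ic_N'_le : ic_N' d N <= N.
Proof. by have [] := ic_fP d_gt0 N_gt0. Qed.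

Lemma leq_parts (b : nat) : N %/ ic_N' d N <= ic_parts d N b.
Proof.
by rewrite /ic_parts; case: ifP => // _; rewrite leq_div2r // leq_addr.
Qed.

Lemma card_group_k_le (k c : nat) :
  (#|ic_group_k n d N k c|%:R <=
     2 * 'C(n, k)%:R / N%:R + 2 ^+ d.+1 + 1 :> R)%R.
Proof.
have N'0 := ic_N'_gt0; have N'N := ic_N'_le.
have q0 : 0 < N %/ ic_N' d N by rewrite divn_gt0.
have bN' : c %% ic_N' d N < ic_N' d N by rewrite ltn_mod.
set b := c %% _ in bN'; set N' := ic_N' d N in N'0 N'N q0 bN'.
rewrite /ic_group_k -/b -/N'.
apply: le_trans (_ : ((#|ic_old_group_idx n d N k b| %/ (N %/ N')).+1%:R <= _)%R).
  rewrite ler_nat (leq_trans (leq_card_round_robin _ _ _)) //.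
    by rewrite (leq_trans q0) // leq_parts.
  by rewrite ltnS leq_div2l // leq_parts.
rewrite -natr1 lerD2r (le_trans (natr_divn_le _ _ _)) //.
have old : (#|ic_old_group_idx n d N k b|%:R <= 'C(n, k)%:R / N'%:R + 2 ^+ d :> R)%R.
  apply: card_old_group_le => //; rewrite -mem_lexlist mem_nth //.
  by rewrite size_lexlist card_ksets.
(* With [q = N %/ N'] at least 1, [N < (q + 1) * N' <= 2 * q * N']. This is the source of the factor
   2 in the bound. *)
have half : (N%:R <= 2 * N'%:R * (N %/ N')%:R :> R)%R.
  rewrite -!natrM ler_nat {1}(divn_eq N N').
  by have := ltn_pmod N N'0; move: q0; nia.
rewrite ler_pdivrMr ?ltr0n // (le_trans old) //.
have x0 : (0 <= 'C(n, k)%:R / (N' * N)%:R :> R)%R by rewrite divr_ge0.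
(* Both quotients are written as multiples of ['C(n, k) / (N' * N)], so that [half] can be
   multiplied by this nonnegative number. *)
have e1 : ('C(n, k)%:R / N'%:R = 'C(n, k)%:R / (N' * N)%:R * N%:R :> R)%R.
  by rewrite natrM; field; rewrite !pnatr_eq0 -!lt0n N'0 ?N_gt0.
have e2 : (2 * 'C(n, k)%:R / N%:R = 'C(n, k)%:R / (N' * N)%:R * (2 * N'%:R) :> R)%R.
  by rewrite natrM; field; rewrite !pnatr_eq0 -!lt0n N'0 ?N_gt0.
rewrite e1 e2 mulrDl; apply: lerD; first by rewrite -[leRHS]mulrA ler_wpM2l.
have p0 : (0 <= 2 ^+ d :> R)%R by rewrite exprn_ge0.
have q1 : (1 <= (N %/ N')%:R :> R)%R by rewrite ler1n.
by rewrite exprS; nra.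
Qed.

End NewGroups.

(** * Binomial coefficients and the number of edges *)

(** After division by the powers, the factors are [1 - i/r] and [1 - i/n]. The former is at most the
    latter, strictly so from [i = 1] on; hence the assumption [1 < d] and an induction starting at
    2. *)
Lemma ltn_ffact_expn (r n d : nat) : 1 < d <= r -> r < n ->
  r ^_ d * n ^ d < n ^_ d * r ^ d.
Proof.
case: d => [|[|d]] // /andP[_ dr] rn.
elim: d dr => [|d IH] dr.
  rewrite !ffactnS !ffactn0 !expnS !expn0; case: r n dr rn => [|r] [|n] //= dr rn.
  nia.
rewrite (ffactnSr r d.+2) (ffactnSr n d.+2) (expnSr n d.+2) (expnSr r d.+2).
rewrite (mulnACA (r ^_ _)) (mulnACA (n ^_ _)).
apply: (@leq_ltn_trans (r ^_ d.+2 * n ^ d.+2 * ((n - d.+2) * r))).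
  by rewrite leq_mul2l; apply/orP; right; nia.
by rewrite ltn_mul2r IH ?(ltnW dr) // andbT muln_gt0 subn_gt0; lia.
Qed.

(** The ratio of the binomials exceeds [(n/r)^d], which is at least [2^(a*d/2)] and so at least
    [2^b]. Squares keep the exponents integral. *)
Lemma ltn_expn_bin (b a r n d : nat) : 1 < d <= r -> r < n ->
  2 ^ a * r ^ 2 <= n ^ 2 -> 2 * b <= a * d -> 2 ^ b * 'C(r, d) < 'C(n, d).
Proof.
move=> dr rn arn bad.
have r0 : 0 < r by lia.
have brn : 2 ^ b * r ^ d <= n ^ d.
  rewrite -leq_sqr expnMn -!expnM (mulnC d 2) [leqRHS]expnM.
  apply: (@leq_trans ((2 ^ a * r ^ 2) ^ d)); last by rewrite leq_exp2r //; lia.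
  by rewrite expnMn -!expnM leq_mul // leq_pexp2l // mulnC.
have := ltn_ffact_expn dr rn; rewrite -!bin_ffact => h.
have {h} : 'C(r, d) * n ^ d < 'C(n, d) * r ^ d.
  by rewrite -(ltn_pmul2l (fact_gt0 d)) mulnA (mulnC d`!) mulnA (mulnC d`!).
move=> /(leq_ltn_trans (leq_mul (leqnn 'C(r, d)) brn)).
by rewrite mulnCA mulnA ltn_pmul2r // expn_gt0 r0.
Qed.

Lemma ltn_bin2l (d r n : nat) : 0 < d <= r -> r < n -> 'C(r, d) < 'C(n, d).
Proof.
case: d => // d /andP[_ dr] rn.
apply: (@leq_trans 'C(r.+1, d.+1)); last exact: leq_bin2l.
by rewrite binS -addn1 leq_add2l bin_gt0 ltnW.
Qed.

Lemma card_edges_nonuniform (n d : nat) :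
  #|edges NonUniformCase n d| = \sum_(1 <= k < d.+1) 'C(n, k).
Proof.
rewrite /edges; elim: d => [|d IH]; first by rewrite !big_geq // cards0.
rewrite big_nat_recr // [RHS]big_nat_recr //= -IH cardsU card_ksets.
suff -> : (\bigcup_(1 <= k < d.+1) ksets n k) :&: ksets n d.+1 = finset.set0.
  by rewrite cards0 subn0.
apply/setP => e; rewrite !inE; apply/negbTE/negP => /andP[+ /eqP ed].
rewrite big_seq; elim/big_ind: _ => [|A B hA hB|k].
- by rewrite inE.
- by rewrite inE => /orP[].
by rewrite mem_index_iota inE ed => /andP[_ kd] /eqP h; rewrite h ltnn in kd.
Qed.

(* 2 ^ excess u d is the factor of N in the denominator of phi_min. *)
Definition excess (u : hypergraph_case) (d : nat) : nat :=
  match u with UniformCase => d.+1 | NonUniformCase => 2 * d + 1 end.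

(** * Consequences of the bounds on [N] and [d] *)

Section Sizes.
Variables (R : realType) (u : hypergraph_case) (n N d : nat).
Hypotheses (hN : (1 <= N)%N) (hd : (2 <= d)%N).
Hypothesis hNd : (N <= 'C(Num.truncn (Num.sqrt ((n * d)%N%:R / 2 : R)), d))%N.
Hypothesis hdn : (d%:R <= n%:R / (match u with UniformCase => 4 | NonUniformCase => 16 end) :> R)%R.

(** Restates the hypotheses over the integers, with [r] the rounded-down square root. Positivity of
    ['C(r, d)] forces [d <= r], and [4 * d <= n] gives [r < n]. *)
Lemma radius_bound : exists r,
  [/\ N <= 'C(r, d), d <= r, 2 * r ^ 2 <= n * d & r < n].
Proof.
exists (Num.truncn (Num.sqrt ((n * d)%N%:R / 2 : R))); move: hNd; set r := Num.truncn _ => hNr.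
have x0 : (0 <= (n * d)%N%:R / 2 :> R)%R by rewrite divr_ge0.
have h : 2 * r ^ 2 <= n * d.
  have : (r%:R ^+ 2 <= Num.sqrt ((n * d)%N%:R / 2 : R) ^+ 2 :> R)%R.
    by rewrite ler_sqr ?nnegrE ?sqrtr_ge0 // truncn_le sqrtr_ge0.
  rewrite sqr_sqrtr // ler_pdivlMr // mulrC -natrX -natrM ler_nat //.
have dr : d <= r by rewrite -bin_gt0 (leq_trans hN).
have dn : 4 * d <= n.
  rewrite -(ler_nat R) natrM; move: hdn; have : (0 <= n%:R :> R)%R by [].
  by case: (u) => ?; lra.
split=> //; nia.
Qed.

Lemma families_fit : ic_f d N * ic_s n d N <= n.
Proof.
have [r [Nr dr h rn]] := radius_bound.
have [df fN _] := ic_fP (ltnW hd) hN.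
have fr : ic_f d N <= r.
  rewrite leqNgt; apply/negP => /(@ltn_bin2l d); rewrite dr (ltnW hd).
  by move=> /(_ isT); rewrite ltnNge (leq_trans fN).
rewrite /ic_s; case: ifP => [dv|_]; first by rewrite mulnC divnK.
move: (ic_f d N) df fr => f df fr {fN}.
(* When [f] does not divide [n], one needs [f * (n %/ (f + d) + 1) <= n], which follows from
   [f * (f + d) <= n * d]. The latter is the sum of [2 * f ^ 2 <= n * d] and [2 * f * d <= n * d],
   halved. *)
have fd : 2 * (f + d) * f <= 2 * n * d.
  have : 2 * f ^ 2 <= n * d by nia.
  suff : 2 * f <= n by nia.
  have d2n : 2 * d <= n by nia.
  rewrite -leq_sqr; nia.
have := leq_trunc_div n (f + d); set q := n %/ _ => qn.
have f0 : 0 < f + d by lia.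
rewrite -(leq_pmul2r f0); nia.
Qed.

(** From [2 * r ^ 2 <= n * d] one gets [8 * r ^ 2 <= n ^ 2] if [4 * d <= n], and
    [32 * r ^ 2 <= n ^ 2] if [16 * d <= n]. These are the exponents 3 and 5 below; the remaining
    condition [2 * b <= a * d] then amounts to [2 <= d]. In the non-uniform case the layer [k = d]
    alone is large enough. *)
Lemma excess_lt : 2 ^ excess u d * N < #|edges u n d|.
Proof.
have [r [Nr dr h rn]] := radius_bound.
have d1r : 1 < d <= r by rewrite hd.
have le : 2 ^ excess u d * N <= 2 ^ excess u d * 'C(r, d) by rewrite leq_mul2l Nr orbT.
apply: (leq_ltn_trans le) => {le}.
move: hdn; case: (u) => hdn'.
  have dn : 4 * d <= n.
    rewrite -(ler_nat R) natrM; move: hdn'; have : (0 <= n%:R :> R)%R by [].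
    by move=> ?; lra.
  rewrite /= card_ksets (@ltn_expn_bin _ 3) //=; nia.
have dn : 16 * d <= n.
  rewrite -(ler_nat R) natrM; move: hdn'; have : (0 <= n%:R :> R)%R by [].
  by move=> ?; lra.
rewrite card_edges_nonuniform big_nat_recr //=; last lia.
apply: (@leq_trans 'C(n, d)); last exact: leq_addl.
by rewrite (@ltn_expn_bin _ 5) //=; nia.
Qed.

Lemma card_ic_group_le (c : nat) :
  (#|ic_group u n d N c|%:R <=
    2 * #|edges u n d|%:R / N%:R + 2 ^+ excess u d + 1 :> R)%R.
Proof.
have hk k := card_group_k_le R (ltnW hd) hN families_fit k c.
case: (u); first by rewrite /= card_ksets hk.
rewrite card_edges_nonuniform /=.
apply: (@le_trans _ _ (\sum_(1 <= k < d.+1) #|ic_group_k n d N k c|%:R)%R).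
  rewrite -natr_sum ler_nat.
  elim/big_rec2: _ => [|I m S _ h]; first by rewrite cards0.
  by rewrite (leq_trans (leq_card_setU _ _)) // leq_add2l.
apply: (le_trans (ler_sum _ (fun k _ => hk k))).
rewrite !big_split /= -mulr_suml -mulr_sumr -natr_sum -!addrA lerD2l.
rewrite !sumr_const_nat subn1 /= -!natrX natr1 -mulrnA -natrD ler_nat.
(* The rounding errors add up to [d * (2 ^ d.+1 + 1)], which [d < 2 ^ d] bounds by
   [2 ^ (2 * d + 1) + 1]. *)
have e : 2 ^ (2 * d + 1) = 2 ^ d.+1 * 2 ^ d by rewrite -expnD; congr (2 ^ _); lia.
have h : d < 2 ^ d by exact: ltn_expl.
by rewrite e; move: h; rewrite expnS; nia.
Qed.

End Sizes.

(** * Law and exponential moments of the random subset *)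

Local Open Scope classical_set_scope.
Local Open Scope ring_scope.

(** Expand the product over all [i] of [x_i + 1], where [x_i] is [a] on [C] and 0 elsewhere. *)
Lemma sum_expr_subsets (R : comNzRingType) (I : finType) (C : {set I}) (a : R) :
  \sum_(J : {set I} | J \subset C) a ^+ #|J| = (1 + a) ^+ #|C|.
Proof.
transitivity (\prod_i ((if i \in C then a else 0) + 1)).
  rewrite bigA_distr /= big_mkcond; apply: eq_bigr => J _.
  rewrite -[RHS]big_mkcond; case: ifP => [/fintype.subsetP JC|/subsetPn[i iJ iC]].
    rewrite (eq_bigr (fun=> a)) ?prodr_const // => i iJ.
    by rewrite JC.
  by rewrite (bigD1 i) //= (negPf iC) mul0r.
rewrite (bigID [in C]) /= [X in _ * X]big1 => [|i /negPf ->]; last by rewrite add0r.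
by rewrite mulr1 -prodr_const; apply: eq_bigr => i ->; rewrite addrC.
Qed.

Section RandomSubset.
Variables (dT : measure_display) (T : measurableType dT) (R : realType).
Variables (P : probability T R) (I : finType) (A : {set I}) (phi : R).
Variable X : T -> {set I}.
Hypothesis hX : random_subset P A phi X.

(** Point masses, taken in [R]: as [X] has finitely many values, all probabilities and expectations
    below become finite real sums. *)
Definition law (S : {set I}) : R := fine (P [set w | X w = S]).

(** The event is empty unless [S] lies in [A]; otherwise it is a finite intersection of membership
    events for [i] in [A] and their complements. *)
Lemma measurable_law (S : {set I}) : measurable [set w | X w = S].
Proof.
have [XA [mX _] _] := hX.
have [SA|SA] := boolP (S \subset A); last first.
  suff -> : [set w | X w = S] = set0 by [].
  apply/seteqP; split=> // w /= XS; move: SA; by rewrite -XS XA.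
have -> : [set w | X w = S] = \bigcap_(i in [set` A])
    (if i \in S then [set w | i \in X w] else ~` [set w | i \in X w]).
  apply/seteqP; split=> [w /= <- i _|w /= h].
    by case: ifPn => //= /negP.
  apply/setP => i; have [iA|iA] := boolP (i \in A).
    by have := h i iA; case: ifPn => /= [_ -> //|_ /negP/negPf].
  have -> : (i \in X w) = false by apply: contraNF iA; exact: (fintype.subsetP (XA w)).
  by symmetry; apply: contraNF iA; exact: (fintype.subsetP SA).
apply: fin_bigcap_measurable => // i iA.
by case: ifP => _; [exact: mX | apply: measurableC; exact: mX].
Qed.

Lemma law_ge0 (S : {set I}) : 0 <= law S.
Proof. by rewrite fine_ge0. Qed.

Lemma prob_law (Q : pred {set I}) :
  P [set w | Q (X w)] = (\sum_(S | Q S) law S)%:E.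
Proof.
have -> : [set w | Q (X w)] = \bigcup_(S in [set` enum Q]) [set w | X w = S].
  apply/seteqP; split=> [w /= h|w [S /= + ->]]; last by rewrite mem_enum.
  by exists (X w) => //=; rewrite mem_enum.
rewrite measure_fin_bigcup //.
- rewrite -fsbig_seq ?enum_uniq // big_enum /= -sumEFin; apply: eq_bigr => S _.
  by rewrite /law fineK // fin_num_measure //; exact: measurable_law.
- by move=> S1 S2 _ _ [w [/= <- <-]].
- by move=> S _; exact: measurable_law.
Qed.

Lemma sum_law : \sum_S law S = 1.
Proof.
apply/EFin_inj; rewrite -(prob_law xpredT) -[RHS](probability_setT P).
by congr (P _); apply/seteqP.
Qed.

(** Independence enters the proof through this identity alone. *)
Lemma sum_law_supsets (J : {set I}) : J \subset A ->
  \sum_(S : {set I} | J \subset S) law S = phi ^+ #|J|.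
Proof.
move=> JA; have [XA [mX indep] hphi] := hX.
apply/EFin_inj; rewrite -(prob_law (fun S => J \subset S)).
have -> : [set w | J \subset X w] = \bigcap_(i in [set` J]) [set w | i \in X w].
  apply/seteqP; split=> [w /= /fintype.subsetP h i /= /h //|w /= h].
  by apply/fintype.subsetP => i iJ; exact: h.
rewrite indep // (eq_bigr (fun=> phi%:E)) => [|i iJ]; last first.
  by apply: hphi; exact: (fintype.subsetP JA).
by rewrite -prodr_const -prodEFin.
Qed.

Lemma law_eq0 (S : {set I}) : ~~ (S \subset A) -> law S = 0.
Proof.
move=> SA; have [XA _ _] := hX.
rewrite /law (_ : [set w | X w = S] = set0) ?measure0 //.
by apply/seteqP; split=> // w /= XS; move: SA; rewrite -XS XA.
Qed.

Lemma sum_law_exprX (B : {set I}) (a : R) : B \subset A ->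
  \sum_S law S * (1 + a) ^+ #|B :&: S| = (1 + a * phi) ^+ #|B|.
Proof.
move=> BA; rewrite -sum_expr_subsets.
under eq_bigr => S _ do rewrite -sum_expr_subsets mulr_sumr.
rewrite (exchange_big_dep (fun J : {set I} => J \subset B)) /=; last first.
  by move=> S J _; rewrite finset.subsetI => /andP[].
apply: eq_bigr => J JB.
rewrite exprMn -sum_law_supsets ?(fintype.subset_trans JB) // mulr_sumr.
by apply: eq_big => S; rewrite ?finset.subsetI ?JB // mulrC.
Qed.

(** Chernoff bound: Markov's inequality for [expR (t * #|B :&: S|)], then [1 + x <= expR x].
    Positive [t] gives the upper tail and negative [t] the lower one. *)
Lemma random_subset_tail (B : {set I}) (t c : R) : 0 <= phi <= 1 -> B \subset A ->
  \sum_(S : {set I} | t * c <= t * #|B :&: S|%:R) law S <=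
    expR ((expR t - 1) * (phi * #|B|%:R) - t * c).
Proof.
move=> /andP[phi0 phi1] BA; rewrite big_mkcond /=.
apply: (@le_trans _ _ (\sum_S law S * (1 + (expR t - 1)) ^+ #|B :&: S| * expR (- (t * c)))).
  apply: ler_sum => S _; rewrite addrC subrK -mulrA -expRM_natr -expRD.
  case: ifP => h; last by rewrite mulr_ge0 ?law_ge0 ?expR_ge0.
  apply: ler_peMr; first exact: law_ge0. by rewrite -[leLHS]expR0 ler_expR subr_ge0.
rewrite -mulr_suml sum_law_exprX // expRD ler_wpM2r ?expR_ge0 //.
rewrite mulrA expRM_natr lerXn2r ?nnegrE ?expR_ge0 //; last exact: expR_ge1Dx.
(* The base equals [(1 - phi) + phi * expR t], which is nonnegative for [phi] in [[0, 1]]. *)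
by have := expR_ge0 t; nra.
Qed.

End RandomSubset.

(** * Numerical bounds on the exponential *)

Lemma expR_inv8_le (R : realType) : expR (8^-1) <= 8 / 7 :> R.
Proof.
have := expR_ge1Dx (- 8^-1 : R); rewrite expRN => h.
have e0 := expR_gt0 (8^-1 : R).
have : (1 - 8^-1) * expR 8^-1 <= (1 : R) by rewrite -ler_pdivlMr // mul1r.
lra.
Qed.

(** Here [64 / 81] is the square of [8 / 9], from [expR (1/8) >= 9/8]. *)
Lemma expRN_inv4_le (R : realType) : expR (- 4^-1) <= 64 / 81 :> R.
Proof.
have h := expR_ge1Dx (8^-1 : R).
have -> : - 4^-1 = - 8^-1 * 2%:R :> R by lra.
have e0 := expR_gt0 (8^-1 : R).
rewrite expRM_natr expRN exprVn -[leRHS]invrK lef_pV2 ?posrE; last 2 first.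
- by rewrite exprn_gt0.
- by rewrite invr_gt0; lra.
by rewrite expr2 invf_div; nra.
Qed.

Lemma expR1_le4 (R : realType) : expR 1 <= 4 :> R.
Proof.
have := expR_ge1Dx (- 2^-1 : R); rewrite expRN => h.
have e0 := expR_gt0 (2^-1 : R).
have : (1 - 2^-1) * expR 2^-1 <= (1 : R) by rewrite -ler_pdivlMr // mul1r.
move=> h1; have -> : 1 = 2^-1 * 2%:R :> R by lra.
rewrite expRM_natr expr2; nra.
Qed.

(** * From size bounds to the load balance factor *)

Lemma leq_ceil_div (a b : nat) : (0 < b)%N -> (a <= ceil_div a b * b)%N.
Proof.
move=> b0; rewrite /ceil_div.
have := divn_eq (a + b.-1) b; have := ltn_pmod (a + b.-1) b0; lia.
Qed.

(* [mu] stands for the expected size of [S]. *)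
Lemma load_balance_le5 (R : realType) (n N : nat) (mu : R)
    (Phi : 'I_N -> {set {set 'I_n}}) (S : {set {set 'I_n}}) :
  (0 < N)%N -> 0 <= mu -> 3 / 4 * mu < #|S|%:R ->
  (forall b, #|Phi b|%:R <= 15 / 4 * (mu / N%:R)) ->
  (S != finset.set0) && (load_balance R Phi S <= 5).
Proof.
move=> N0 mu0 low up.
have S0 : (0 < #|S|)%N by rewrite -(ltr_nat R); lra.
rewrite -card_gt0 S0 /=.
have cN := leq_ceil_div #|S| N0.
have c0 : (0 < ceil_div #|S| N)%N.
  by rewrite lt0n; apply/eqP => h; move: cN; rewrite h mul0n; lia.
rewrite /load_balance ler_pdivrMr ?ltr0n // -natrM ler_nat.
apply/bigmax_leqP => b _; rewrite -(ler_nat R) natrM.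
apply: le_trans (up b) _.
have {}cN : #|S|%:R <= (ceil_div #|S| N)%:R * N%:R :> R by rewrite -natrM ler_nat.
(* The constant 5 is the quotient of [15 / 4] by [3 / 4]. *)
rewrite mulrA ler_pdivrMr ?ltr0n // -mulrA; lra.
Qed.

(** * Tail estimates for all groups and the union bound *)

Theorem proposition1 (R : realType) (u : hypergraph_case) (n N d : nat) (z phi : R)
    (dT : measure_display) (T : measurableType dT) (P : probability T R)
    (X : T -> {set {set 'I_n}})
    (hn : (1 <= n)%N) (hN : (1 <= N)%N) (hd : (2 <= d)%N)
    (hNd : (N <= 'C(Num.truncn (Num.sqrt ((n * d)%N%:R / 2 : R)), d))%N)
    (hz : 1 <= z)
    (hdn : d%:R <= n%:R / (match u with UniformCase => 4 | NonUniformCase => 16 end) :> R)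
    (hphi : phi_min u n d N z <= phi <= 1)
    (hX : random_subset P (edges u n d) phi X) :
  ((1 - 1 / n%:R `^ z)%:E <=
    P [set w | X w != finset.set0 /\
               (load_balance R (ic_partition u d N (X w)) (X w) <= 5 :> R)%R])%E.
Proof.
set A := edges u n d; set M : R := #|A|%:R.
set good := fun S : {set {set 'I_n}} =>
  (S != finset.set0) && (load_balance R (ic_partition u d N S) S <= 5).
have -> : [set w | X w != finset.set0 /\
    (load_balance R (ic_partition u d N (X w)) (X w) <= 5 :> R)%R] =
    [set w | good (X w)].
  by apply/seteqP; split=> [w /= [h1 h2]|w /= /andP//]; exact/andP.
rewrite (prob_law hX good) lee_fin.
have N0 : 0 < N%:R :> R by rewrite ltr0n.
pose D : R := 2 ^+ excess u d.
have DM : D * N%:R < M.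
  by rewrite /D -natrX -natrM ltr_nat (excess_lt hN hd hNd hdn).
have D2 : 2 <= D.
  rewrite /D -natrX ler_nat; apply: (@leq_trans (2 ^ 1)%N) => //.
  by rewrite leq_exp2l //; case: (u) => /=; lia.
have N2M : 2 * N%:R < M by nra.
have M0 : 0 < M by lra.
have nz1 : 1 <= n%:R `^ z.
  by rewrite -[leLHS](powRr0 n%:R) ler_powR ?ler1n //; lra.
have cardB b : #|ic_group u n d N b|%:R <= 3 * (M / N%:R) + 1 :> R.
  apply: le_trans (card_ic_group_le hN hd hNd hdn b) _.
  rewrite lerD2r -/M -/D -mulrA.
  have : D <= M / N%:R by rewrite ler_pdivlMr // ltW.
  lra.
case/andP: hphi; rewrite /phi_min ge_min => /orP[hphi|phi_ge1] phi1; last first.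
  have {phi1 phi_ge1} phi1 : phi = 1 by apply/le_anti/andP.
  (* For [phi = 1], [A] is contained in [X] with probability 1, and [A] is the only such subset of
     [A]. *)
  have lawA : law P X A = 1.
    rewrite -(expr1n _ #|A|) -phi1 -(sum_law_supsets hX (fintype.subxx A)).
    rewrite (bigD1 A) //= big1 ?addr0 // => S /andP[AS SA].
    by rewrite (law_eq0 hX) //; apply: contra SA => SA; rewrite finset.eqEsubset SA.
  have goodA : good A.
    apply: (@load_balance_le5 _ _ _ M) => //; rewrite ?ltW //.
      by rewrite -/M; lra.
    move=> b; apply: le_trans (_ : #|ic_group u n d N b|%:R <= _).
      by rewrite ler_nat; apply: subset_leq_card; exact: finset.subsetIl.
    apply: le_trans (cardB b) _.
    have : 2 <= M / N%:R by rewrite ler_pdivlMr // ltW.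
    lra.
  rewrite (bigD1 A) //= lawA.
  have : 0 <= \sum_(S | good S && (S != A)) law P X S.
    by apply: sumr_ge0 => S _; exact: law_ge0.
  have : 0 <= 1 / n%:R `^ z :> R by rewrite divr_ge0 // powR_ge0.
  lra.
pose L := ln (4 * N%:R * n%:R `^ z).
have L1 : 1 <= L.
  rewrite /L -ler_expR lnK ?posrE; last by rewrite !mulr_gt0 //; lra.
  apply: le_trans (expR1_le4 R) _.
  have : 1 <= N%:R :> R by rewrite ler1n.
  nra.
have denom0 : 0 < M - D * N%:R by rewrite subr_gt0.
have {}hphi : 54 * N%:R * L <= phi * (M - D * N%:R).
  rewrite -ler_pdivrMr //; move: hphi; rewrite -/L /M /D /A.
  case: (u); first by rewrite /= card_ksets.
  by rewrite -card_edges_nonuniform /excess addn1.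
have phi0 : 0 <= phi by nra.
have phi01 : 0 <= phi <= 1 by rewrite phi0.
pose mu := phi * M.
have muN : 54 * N%:R * L <= mu.
  have : 0 <= phi * (D * N%:R) by rewrite !mulr_ge0 //; lra.
  by rewrite /mu; lra.
have hm : 54 * L <= mu / N%:R by rewrite ler_pdivlMr //; lra.
have mu0 : 0 <= mu by rewrite mulr_ge0 // ltW.
have expL : expR (- L) = (4 * N%:R * n%:R `^ z)^-1.
  by rewrite expRN lnK // posrE !mulr_gt0 //; lra.
(* Intersecting with [A] meets the hypothesis of the tail bound and leaves the trace on any [S]
   inside [A] unchanged. *)
pose B (b : 'I_N) := ic_group u n d N b :&: A.
pose tl : R := - 4^-1; pose tu : R := 8^-1.
pose cl := 3 / 4 * mu; pose cu := 15 / 4 * (mu / N%:R).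
(* The exponent is at most [(64/81 - 1 + 3/16) * mu = - 29/1296 * mu], which is below [- L] because
   [mu >= 54 * N * L] and [29 * 54 > 1296]. *)
have low : \sum_(S : {set {set 'I_n}} | tl * cl <= tl * #|A :&: S|%:R) law P X S <= expR (- L).
  apply: le_trans (random_subset_tail hX tl cl phi01 (fintype.subxx A)) _.
  rewrite ler_expR -/M -/mu /tl /cl.
  have := expRN_inv4_le R; have : 1 <= N%:R :> R by rewrite ler1n.
  nra.
(* With [m = mu / N], the exponent is at most [(3 * m + 1) / 7 - 15/32 * m = 1/7 - 9/224 * m], which
   is below [- L] because [m >= 54 * L] and [L >= 1]. *)
have up b : \sum_(S : {set {set 'I_n}} | tu * cu <= tu * #|B b :&: S|%:R) law P X S <= expR (- L).
  have BA : B b \subset A by exact: finset.subsetIr.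
  apply: le_trans (random_subset_tail hX tu cu phi01 BA) _.
  have hB : phi * #|B b|%:R <= 3 * (mu / N%:R) + 1.
    apply: le_trans (_ : phi * (3 * (M / N%:R) + 1) <= _).
      rewrite ler_wpM2l // (le_trans _ (cardB b)) // ler_nat.
      by apply: subset_leq_card; exact: finset.subsetIl.
    by rewrite /mu mulrDr mulr1 lerD // -mulrA mulrCA lexx.
  rewrite ler_expR /tu /cu.
  have := expR_inv8_le R; have := expR_ge1Dx (8^-1 : R).
  have : 0 <= phi * #|B b|%:R by rewrite mulr_ge0.
  nra.
have bad : \sum_(S | ~~ good S) law P X S <= (1 + N%:R) * expR (- L).
  rewrite mulrDl mul1r.
  apply: le_trans (lerD low (_ : \sum_(b < N) \sum_(S : {set {set 'I_n}} |
     tu * cu <= tu * #|B b :&: S|%:R) law P X S <= _)); last first.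
    apply: le_trans (ler_sum _ (fun b _ => up b)) _.
    by rewrite sumr_const card_ord mulr_natl.
  under [X in _ + X]eq_bigr => b _ do rewrite big_mkcond.
  rewrite exchange_big /= [X in X + _]big_mkcond [leLHS]big_mkcond -big_split /=.
  (* Union bound, one [S] at a time: a bad [S] of nonzero mass lies in [A] and satisfies at least
     one of the [N + 1] tail conditions, since otherwise [load_balance_le5] would make it good. *)
  apply: ler_sum => S _; have lS := law_ge0 P X S.
  have sum0 : 0 <= \sum_(b < N) (if tu * cu <= tu * #|B b :&: S|%:R then law P X S else 0).
    by apply: sumr_ge0 => b _; case: ifP.
  case: ifPn => [ngood|_]; last by rewrite addr_ge0 //; case: ifP.
  have [SA|SA] := boolP (S \subset A); last first.
    by rewrite (law_eq0 hX SA) if_same big1 ?addr0 // => b _; rewrite if_same.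
  case: ifPn => [_|nlow]; first by rewrite lerDl.
  rewrite add0r.
  have [/existsP[b hb]|/existsPn nup] :=
    boolP [exists b : 'I_N, tu * cu <= tu * #|B b :&: S|%:R].
    rewrite (bigD1 b) //= hb lerDl.
    by apply: sumr_ge0 => b' _; case: ifP.
  case/negP: ngood; apply: (@load_balance_le5 _ _ _ mu) => //.
    by move: nlow; rewrite (finset.setIidPr SA) -ltNge /tl /cl; lra.
  move=> b; have := nup b.
  rewrite /B -finset.setIA (finset.setIidPr SA) -ltNge /tu /cu /ic_partition; lra.
have := sum_law hX; rewrite (bigID good) /= => tot.
have -> : \sum_(S | good S) law P X S = 1 - \sum_(S | ~~ good S) law P X S by lra.
rewrite lerD2l lerN2 (le_trans bad) // expL div1r.
have nz0 : 0 < n%:R `^ z by lra.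
(* What remains is [1 + N <= 4 * N]. *)
rewrite ler_pdivrMr ?mulr_gt0 // mulrC mulfK ?gt_eqF //.
have : 1 <= N%:R :> R by rewrite ler1n.
lra.
Qed.
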